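(* Let $r>0$. The set $$\mathcal Y=\Big\{(\bm x,\upsilon,k)\in\mathcal X\times\mathbb R\times\mathbb R_+:\ \|\bm A(\bm x)\bm z+\bm a(\bm x)\|_2^2+\bm b(\bm x)^\top\bm z+c(\bm x)\le k\,\bm z^\top\bm z+\upsilon\ \ \forall\bm z\in\mathcal E_r\Big\}$$ is equal to the set of all $(\bm x,\upsilon,k)\in\mathcal X\times\mathbb R\times\mathbb R_+$ for which there exists $\lambda\ge0$ with $$\begin{bmatrix}\bm I_{n_a}&\bm a(\bm x)&\bm A(\bm x)\\ \bm a(\bm x)^\top&-c(\bm x)+\upsilon-\lambda r^2&-\tfrac12\bm b(\bm x)^\top\\ \bm A(\bm x)^\top&-\tfrac12\bm b(\bm x)&(k+\lambda)\bm I_{n_z}\end{bmatrix}\succeq\bm 0 .$$ Moreover, the set is feasible for any $\bm x\in\mathcal X$ and $\upsilon>g(\bm x,\bm 0)=\|\bm a(\bm x)\|_2^2+c(\bm x)$; that is, for any such $\bm x,\upsilon$ there exists $k\in\mathbb R_+$ with $(\bm x,\upsilon,k)\in\mathcal Y$.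
   Context: $\mathcal X\subseteq\mathbb R^{n_x}$. The maps $\bm a:\mathbb R^{n_x}\to\mathbb R^{n_a}$, $\bm A:\mathbb R^{n_x}\to\mathbb R^{n_a\times n_z}$, $\bm b:\mathbb R^{n_x}\to\mathbb R^{n_z}$, $c:\mathbb R^{n_x}\to\mathbb R$ are affine. The evaluation function is $g(\bm x,\bm z)=\|\bm A(\bm x)\bm z+\bm a(\bm x)\|_2^2+\bm b(\bm x)^\top\bm z+c(\bm x)$. $\mathcal E_r=\{\bm z\in\mathbb R^{n_z}:\|\bm z\|_2\le r\}$. $\bm I_n$ is the $n\times n$ identity matrix, and $\succeq\bm 0$ means positive semidefinite. *)

(* Defs.v *)
From HB Require Import structures.
From mathcomp Require Import all_boot all_order all_algebra.
From mathcomp Require Import all_classical all_reals.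

Set Implicit Arguments.
Unset Strict Implicit.
Unset Printing Implicit Defensive.

Import Order.TTheory GRing.Theory Num.Theory.

Local Open Scope classical_set_scope.
Local Open Scope ring_scope.

Definition affine_map (R : realType) (U V : lmodType R) (f : U -> V) : Prop :=
  exists (L : {linear U -> V}) (v : V), forall u, f u = L u + v.

(* The library norm on matrices is the sup norm, hence this Euclidean norm. *)
Definition norm2 (R : realType) (n : nat) (v : 'cV[R]_n) : R :=
  Num.sqrt (\sum_(i < n) v i ord0 ^+ 2).

Definition l2ball (R : realType) (n : nat) (r : R) : set 'cV[R]_n :=
  [set z | norm2 z <= r].

(* Over the reals, nonnegativity of the quadratic form does not force
   symmetry, so symmetry is part of the definition. *)
Definition psdmx (R : realType) (n : nat) (M : 'M[R]_n) : Prop :=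
  M^T = M /\ forall v : 'cV[R]_n, 0 <= (v^T *m M *m v) ord0 ord0.

Section EvaluationFunction.

Variables (R : realType) (nx na nz : nat).
Variables (X : set 'cV[R]_nx).
Variables (A : 'cV[R]_nx -> 'M[R]_(na, nz)) (a : 'cV[R]_nx -> 'cV[R]_na).
Variables (b : 'cV[R]_nx -> 'cV[R]_nz) (c : 'cV[R]_nx -> R).

Definition evalg (x : 'cV[R]_nx) (z : 'cV[R]_nz) : R :=
  norm2 (A x *m z + a x) ^+ 2 + ((b x)^T *m z) ord0 ord0 + c x.

Definition majorant_set (r : R) : set ('cV[R]_nx * R * R) :=
  [set p | let: (x, upsilon, k) := p in
    [/\ X x, 0 <= k &
        forall z, l2ball r z ->
          evalg x z <= k * (z^T *m z) ord0 ord0 + upsilon]].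

Definition lmi_mx (r : R) (x : 'cV[R]_nx) (upsilon k lambda : R) :
    'M[R]_(na + (1 + nz)) :=
  block_mx
    1%:M (row_mx (a x) (A x))
    (col_mx (a x)^T (A x)^T)
    (block_mx
      (- c x + upsilon - lambda * r ^+ 2)%:M (- (2^-1 *: (b x)^T))
      (- (2^-1 *: b x)) (k + lambda)%:M).

Definition lmi_set (r : R) : set ('cV[R]_nx * R * R) :=
  [set p | let: (x, upsilon, k) := p in
    [/\ X x, 0 <= k &
        exists2 lambda : R, 0 <= lambda & psdmx (lmi_mx r x upsilon k lambda)]].

End EvaluationFunction.

Arguments evalg {R nx na nz} A a b c x z.
Arguments majorant_set {R nx na nz} X A a b c r.
Arguments lmi_mx {R nx na nz} A a b c r x upsilon k lambda.
Arguments lmi_set {R nx na nz} X A a b c r.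

(* Main.v *)
Require Import Defs.
From HB Require Import structures.
From mathcomp Require Import all_boot all_order all_algebra.
From mathcomp Require Import ring lra.
From mathcomp Require Import all_classical all_reals.

Import Order.TTheory GRing.Theory Num.Theory.
Local Open Scope classical_set_scope.
Local Open Scope ring_scope.

(** The defining inequality says that the inhomogeneous quadratic polynomial
    F(z) = k z^T z + upsilon - g(x, z) is nonnegative wherever r^2 - z^T z is.
    Adding a coordinate t turns both into quadratic forms in (t, z), given by
    the matrices [gap_mx] and [ball_mx], and the implication survives
    ([qform_ge0_homogenize]): off t = 0 one rescales, and at t = 0 the
    constraint leaves only z = 0. The S-lemma ([S_lemma]) then gives l >= 0
    such that gap_mx - l * ball_mx is a nonnegative form, and the Schur
    complement of the identity block ([psdmx_schur]) says that this is the
    positive semidefiniteness of the matrix in the theorem. The converse is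
    evaluation at t = 1.

    The S-lemma is proved without compactness or convexity. A multiplier l of
    M against N must lie above the ratio qform M u / qform N u when
    qform N u < 0, and below it when qform N u > 0. On the line u + t v
    through a point of each kind, the form of N vanishes at one negative and
    one positive t. The form of M is nonnegative at both, and the
    combination of these two values that cancels the cross term says that the
    ratio at u is at most the ratio at v ([qform_ratio_le]). So the supremum
    of the ratios of the first kind, together with 0, is a multiplier.

    Feasibility holds because F(0) = upsilon - g(x, 0) > 0 is a slack that
    absorbs the linear part of g, up to a multiple of z^T z, while every
    quadratic form is at most a multiple of z^T z ([qform_affine_le]). *)

(** * Quadratic forms and dot products *)

Definition qform {R : comNzRingType} {n : nat} (M : 'M[R]_n) (v : 'cV[R]_n) : R :=
  (v^T *m M *m v) ord0 ord0.

Lemma qformDZ {R : comNzRingType} {n : nat} (M : 'M[R]_n) (u v : 'cV[R]_n) (t : R) :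
  qform M (u + t *: v) =
  qform M u + t * ((u^T *m M *m v) ord0 ord0 + (v^T *m M *m u) ord0 ord0)
  + t ^+ 2 * qform M v.
Proof.
rewrite /qform [(u + _)^T]linearD /= [(t *: v)^T]linearZ /=.
rewrite !mulmxDl !mulmxDr -!scalemxAl -!scalemxAr.
rewrite !mxE; ring.
Qed.

Lemma qformZ {R : comNzRingType} {n : nat} (M : 'M[R]_n) (v : 'cV[R]_n) (t : R) :
  qform M (t *: v) = t ^+ 2 * qform M v.
Proof.
by rewrite /qform [(t *: v)^T]linearZ /= -!scalemxAl -scalemxAr !mxE; ring.
Qed.

Lemma qform_mulmx {R : comNzRingType} {m n : nat} (W : 'M[R]_(m, n)) (v : 'cV[R]_n) :
  qform (W^T *m W) v = ((W *m v)^T *m (W *m v)) ord0 ord0.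
Proof. by rewrite /qform trmx_mul !mulmxA. Qed.

Lemma qformB {R : comNzRingType} {n : nat} (M N : 'M[R]_n) (v : 'cV[R]_n) (l : R) :
  qform (M - l *: N) v = qform M v - l * qform N v.
Proof. by rewrite /qform mulmxBr mulmxBl -scalemxAr -scalemxAl !mxE. Qed.

Lemma dotC {R : comNzRingType} {n : nat} (u v : 'cV[R]_n) :
  (u^T *m v) ord0 ord0 = (v^T *m u) ord0 ord0.
Proof. by rewrite -[in RHS](trmxK u) -trmx_mul [RHS]mxE. Qed.

Lemma dotD {R : comNzRingType} {n : nat} (u v : 'cV[R]_n) :
  ((u + v)^T *m (u + v)) ord0 ord0 =
  (u^T *m u) ord0 ord0 + 2 * (v^T *m u) ord0 ord0 + (v^T *m v) ord0 ord0.
Proof.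
rewrite [(u + v)^T]linearD /= mulmxDl !mulmxDr mxE [X in X + _]mxE [X in _ + X]mxE.
by rewrite (dotC u v); ring.
Qed.

Lemma norm2_sqr {R : realType} {n : nat} (v : 'cV[R]_n) :
  norm2 v ^+ 2 = (v^T *m v) ord0 ord0.
Proof.
rewrite sqr_sqrtr; last by apply: sumr_ge0 => i _; exact: sqr_ge0.
by rewrite mxE; apply: eq_bigr => i _; rewrite mxE.
Qed.

Lemma dot_le0_eq0 {R : realDomainType} {n : nat} (v : 'cV[R]_n) :
  (v^T *m v) ord0 ord0 <= 0 -> v = 0.
Proof.
have sq_ge0 i : true -> 0 <= v^T ord0 i * v i ord0.
  by rewrite mxE -expr2 sqr_ge0.
move=> v_le0; have /psumr_eq0P v0 := sq_ge0.
have /v0 {}v0 : \sum_i v^T ord0 i * v i ord0 = 0.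
  by apply/eqP; rewrite eq_le sumr_ge0 // andbT; move: v_le0; rewrite mxE.
apply/colP => i; rewrite mxE; apply/eqP.
by have /eqP := v0 i isT; rewrite mxE mulf_eq0 orbb.
Qed.

(** * The S-lemma *)

(** The product p / s of the roots of s t^2 + q t + p is negative, so the
    discriminant exceeds q^2. Vieta's relations are recorded, rather than the
    root equations, because they eliminate p and q by [ring]. *)
Lemma opposite_sign_roots {R : rcfType} {p : R} (q : R) {s : R} :
  p < 0 -> 0 < s ->
  exists x y, [/\ x < 0, 0 < y, s * (x + y) = - q & s * (x * y) = p].
Proof.
move=> p_lt0 s_gt0; pose d := Num.sqrt (q ^+ 2 - 4 * (p * s)).
have disc_gt0 : 0 < - (4 * (p * s)) by rewrite oppr_gt0 pmulr_rlt0 // nmulr_rlt0.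
have d_sqr : d ^+ 2 = q ^+ 2 - 4 * (p * s).
  by rewrite sqr_sqrtr // addr_ge0 ?sqr_ge0 // ltW.
have : `|q| < d.
  by rewrite -ltr_sqr ?nnegrE ?sqrtr_ge0 // real_normK ?num_real // d_sqr ltrDl.
rewrite ltr_norml => /andP[qd1 qd2].
have s_neq0 : s != 0 by rewrite gt_eqF.
exists ((- q - d) / (2 * s)), ((- q + d) / (2 * s)); split.
- by rewrite pmulr_llt0 ?invr_gt0; lra.
- by rewrite divr_gt0 //; lra.
- by field.
- suff -> : s * ((- q - d) / (2 * s) * ((- q + d) / (2 * s)))
      = (q ^+ 2 - d ^+ 2) / (4 * s) by rewrite d_sqr; field.
  by field.
Qed.

(** With x < 0 < y the zeros of t |-> qform N (u + t v), the weights y and -x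
    are those for which the terms linear in t cancel:
    y * qform M (u + x v) - x * qform M (u + y v)
      = (y - x) * (qform M u - x y * qform M v),
    and x y = qform N u / qform N v. *)
Lemma qform_ratio_le {R : rcfType} {n : nat} (M N : 'M[R]_n) (u v : 'cV[R]_n) :
  (forall w, qform N w = 0 -> 0 <= qform M w) ->
  qform N u < 0 -> 0 < qform N v ->
  qform M u / qform N u <= qform M v / qform N v.
Proof.
move=> M_ge0 Nu Nv.
pose be P := (u^T *m P *m v) ord0 ord0 + (v^T *m P *m u) ord0 ord0.
have [x [y [x_lt0 y_gt0 xDy xMy]]] := opposite_sign_roots (be N) Nu Nv.
have beN : be N = - (qform N v * (x + y)) by rewrite xDy opprK.
have Mx : 0 <= qform M (u + x *: v).
  by apply: M_ge0; rewrite qformDZ -/(be N) beN -xMy; ring.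
have My : 0 <= qform M (u + y *: v).
  by apply: M_ge0; rewrite qformDZ -/(be N) beN -xMy; ring.
rewrite ler_pdivlMr // mulrAC ler_ndivrMr // -xMy.
rewrite -subr_ge0; have yx_gt0 : 0 < y - x by lra.
rewrite -(pmulr_rge0 _ yx_gt0).
have -> : (y - x) * (qform M u * qform N v
                    - qform M v * (qform N v * (x * y)))
  = qform N v *
    (y * qform M (u + x *: v) + (- x) * qform M (u + y *: v)).
  by rewrite !qformDZ; ring.
by rewrite mulr_ge0 ?addr_ge0 ?mulr_ge0 ?oppr_ge0 // ltW.
Qed.

(** The point [v0] is Slater's condition: it bounds the supremum that defines
    the multiplier. *)
Lemma S_lemma {R : realType} {n : nat} {M N : 'M[R]_n} {v0 : 'cV[R]_n} :
  0 < qform N v0 ->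
  (forall v, 0 <= qform N v -> 0 <= qform M v) ->
  exists2 l : R, 0 <= l & forall v, 0 <= qform (M - l *: N) v.
Proof.
move=> Nv0 MN.
have M0 w : qform N w = 0 -> 0 <= qform M w.
  by move=> Nw; apply: MN; rewrite Nw.
(* 0 is added to make the supremum nonnegative; it is a lower bound of the
   ratios on the side qform N v > 0 because qform M v >= 0 there. *)
pose S := [set 0] `|`
  [set qform M u / qform N u | u in [set u | qform N u < 0]].
have S0 : S 0 by left.
have ubS v : 0 < qform N v -> ubound S (qform M v / qform N v).
  move=> Nv l [->|[u Nu <-]]; last exact: qform_ratio_le.
  by rewrite divr_ge0 ?MN // ltW.
have supS : has_sup S.
  by split; [exists 0 | exists (qform M v0 / qform N v0); exact: ubS].
exists (sup S); first exact: sup_upper_bound.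
move=> v; rewrite qformB subr_ge0.
have [Nv|Nv|Nv] := ltgtP (qform N v) 0.
- rewrite -ler_ndivrMr //; apply: sup_upper_bound => //.
  by right; exists v.
- rewrite -ler_pdivlMr //; apply: ge_sup; first by exists 0.
  exact: ubS.
- by rewrite Nv mulr0; exact: M0.
Qed.

(** * Schur complement of an identity block *)

(** Completing the square in the first block of variables. *)
Lemma qform_schur {R : comNzRingType} {m n : nat} (W : 'M[R]_(m, n)) (C : 'M[R]_n)
    (w : 'cV[R]_m) (y : 'cV[R]_n) :
  qform (block_mx 1%:M W W^T C) (col_mx w y) =
  ((w + W *m y)^T *m (w + W *m y)) ord0 ord0 + qform (C - W^T *m W) y.
Proof.
rewrite -[X in C - X]scale1r qformB mul1r qform_mulmx /qform.
rewrite tr_col_mx mul_row_block mul_row_col mulmx1 [(w + _)^T]linearD /=.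
rewrite mulmxDr !mulmxDl trmx_mul !mulmxA !mxE; ring.
Qed.

Lemma psdmx_schur {R : realType} {m n : nat} (W : 'M[R]_(m, n)) (C : 'M[R]_n) :
  psdmx (block_mx 1%:M W W^T C) <->
  C^T = C /\ forall y, 0 <= qform (C - W^T *m W) y.
Proof.
split=> [[]|[CT psdC]].
  rewrite tr_block_mx trmxK trmx1 => /eq_block_mx[_ _ _ CT] psd; split=> // y.
  (* This first block annihilates the completed square. *)
  have := psd (col_mx (- (W *m y)) y).
  by rewrite -/(qform _ _) qform_schur addNr mulmx0 [X in X + _]mxE add0r.
split=> [|v]; first by rewrite tr_block_mx trmxK trmx1 CT.
rewrite -/(qform _ _) -[v]vsubmxK qform_schur -norm2_sqr.
by rewrite addr_ge0 ?sqr_ge0.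
Qed.

(** * Bounding a quadratic polynomial by a multiple of the squared norm *)

(** Each product |z_i z_j| is at most z^T z, so the sum of the absolute values
    of the entries of Q serves as the constant. *)
Lemma qform_le_dot {R : realDomainType} {n : nat} (Q : 'M[R]_n) :
  exists2 K : R, 0 <= K & forall z, qform Q z <= K * (z^T *m z) ord0 ord0.
Proof.
exists (\sum_j \sum_i `|Q i j|) => [|z].
  by apply: sumr_ge0 => j _; apply: sumr_ge0.
rewrite /qform mxE mulr_suml; apply: ler_sum => j _.
rewrite mxE !mulr_suml; apply: ler_sum => i _.
have sqr_le k : z k ord0 ^+ 2 <= (z^T *m z) ord0 ord0.
  rewrite mxE (bigD1 k) //= mxE -expr2 lerDl.
  by apply: sumr_ge0 => l _; rewrite mxE -expr2 sqr_ge0.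
rewrite mxE mulrAC mulrC; apply: le_trans (ler_norm _) _.
rewrite normrM ler_wpM2l // ler_norml.
have := sqr_le i; have := sqr_le j.
have := sqr_ge0 (z i ord0 + z j ord0); have := sqr_ge0 (z i ord0 - z j ord0).
by rewrite sqrrB sqrrD => *; apply/andP; split; lra.
Qed.

(** By Young's inequality, h^T z <= d + (h^T z)^2 / (4 d), and the square is the
    quadratic form of h h^T, so the linear term can be moved into Q. *)
Lemma qform_affine_le {R : realFieldType} {n : nat} (Q : 'M[R]_n) (h : 'cV[R]_n)
    {d : R} : 0 < d ->
  exists2 K : R, 0 <= K & forall z,
    qform Q z + (h^T *m z) ord0 ord0 <= K * (z^T *m z) ord0 ord0 + d.
Proof.
move=> d_gt0.
(* This is Q + (4 d)^-1 h h^T, signed to match [qformB]. *)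
have [K K_ge0 le_K] := qform_le_dot (Q - (- (4 * d)^-1) *: (h *m h^T)).
exists K => // z; apply: le_trans (lerD (le_K z) (lexx d)).
have -> : qform (Q - (- (4 * d)^-1) *: (h *m h^T)) z
        = qform Q z + (4 * d)^-1 * (h^T *m z) ord0 ord0 ^+ 2.
  rewrite qformB mulNr opprK; congr (_ + _ * _).
  have -> : h *m h^T = (h^T)^T *m h^T by rewrite trmxK.
  by rewrite qform_mulmx mxE big_ord1 mxE expr2.
rewrite -addrA lerD2l; set s := (h^T *m z) ord0 ord0.
rewrite -subr_ge0.
suff -> : (4 * d)^-1 * s ^+ 2 + d - s = (s - 2 * d) ^+ 2 / (4 * d).
  by rewrite divr_ge0 ?sqr_ge0 //; lra.
by field; rewrite gt_eqF.
Qed.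

(** * Homogenization over the ball *)

Lemma qform_scalar_blocks {R : comNzRingType} {n : nat} (s l : R) (h z : 'cV[R]_n)
    (t : R) :
  qform (block_mx s%:M h^T h l%:M) (col_mx t%:M z) =
  s * t ^+ 2 + 2 * t * (h^T *m z) ord0 ord0 + l * (z^T *m z) ord0 ord0.
Proof.
have hz := dotC z h.
rewrite /qform tr_col_mx mul_row_block mul_row_col tr_scalar_mx.
rewrite mulmxDl !mulmxDl !mul_mx_scalar !mul_scalar_mx -?scalemxAl.
move: (z^T *m h) (h^T *m z) (z^T *m z) hz => p q w pq.
by rewrite !mxE pq eqxx mulr1n; ring.
Qed.

(** The form (r t)^2 - z^T z. The off-diagonal block is written 0^T to match
    the shape in [qform_scalar_blocks]. *)
Definition ball_mx {R : comNzRingType} (n : nat) (r : R) : 'M[R]_(1 + n) :=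
  block_mx (r ^+ 2)%:M 0^T 0 (- 1)%:M.

(** The homogenization of k z^T z + upsilon - g(x, z), where the pair (t, z)
    makes the squared term |t a + A z|^2. The same subtracted product is what
    the Schur complement produces from the first block row. *)
Definition gap_mx {R : fieldType} {na nz : nat} (A : 'M[R]_(na, nz)) (a : 'cV[R]_na)
    (b : 'cV[R]_nz) (c upsilon k : R) : 'M[R]_(1 + nz) :=
  block_mx (- c + upsilon)%:M (- (2^-1 *: b))^T (- (2^-1 *: b)) k%:M
  - (row_mx a A)^T *m row_mx a A.

Lemma qform_ball_mx {R : comNzRingType} {n : nat} (r t : R) (z : 'cV[R]_n) :
  qform (ball_mx n r) (col_mx t%:M z) = (r * t) ^+ 2 - (z^T *m z) ord0 ord0.
Proof. by rewrite qform_scalar_blocks trmx0 mul0mx mxE; ring. Qed.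

Lemma qform_gap_mx {R : realType} {nx na nz : nat}
    (A : 'cV[R]_nx -> 'M[R]_(na, nz)) (a : 'cV[R]_nx -> 'cV[R]_na)
    (b : 'cV[R]_nx -> 'cV[R]_nz) (c : 'cV[R]_nx -> R) (x : 'cV[R]_nx)
    (upsilon k : R) (z : 'cV[R]_nz) :
  qform (gap_mx (A x) (a x) (b x) (c x) upsilon k) (col_mx 1%:M z) =
  k * (z^T *m z) ord0 ord0 + upsilon - evalg A a b c x z.
Proof.
rewrite /gap_mx -[X in _ - X]scale1r qformB qform_scalar_blocks qform_mulmx.
rewrite mul_row_col mulmx1 [a x + _]addrC /evalg norm2_sqr.
rewrite [(- _)^T]linearN /= [(_ *: b x)^T]linearZ /= mulNmx -scalemxAl.
by rewrite 2!mxE; field.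
Qed.

Lemma l2ball_qform {R : realType} {n : nat} {r : R} (z : 'cV[R]_n) :
  0 < r -> l2ball r z <-> 0 <= qform (ball_mx n r) (col_mx 1%:M z).
Proof.
move=> r_gt0; rewrite qform_ball_mx mulr1 -norm2_sqr subr_ge0.
by rewrite ler_sqr ?nnegrE ?sqrtr_ge0 // ltW.
Qed.

(** At infinity (t = 0) the ball imposes -z^T z >= 0, so boundedness of the ball
    makes the homogenized constraint trivial there. *)
Lemma qform_ge0_homogenize {R : realType} {n : nat} {r : R} (M : 'M[R]_(1 + n)) :
  (forall z, 0 <= qform (ball_mx n r) (col_mx 1%:M z) ->
     0 <= qform M (col_mx 1%:M z)) ->
  forall v, 0 <= qform (ball_mx n r) v -> 0 <= qform M v.
Proof.
move=> Mz v; rewrite -[v]vsubmxK.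
rewrite [usubmx v]mx11_scalar; set t := usubmx v _ _; set z := dsubmx v.
have [t0|t_neq0] := eqVneq t 0.
  rewrite qform_ball_mx t0 mulr0 expr0n sub0r oppr_ge0 => /dot_le0_eq0 ->.
  by rewrite raddf0 col_mx0 /qform mulmx0 mxE.
have -> : col_mx t%:M z = t *: col_mx 1%:M (t^-1 *: z).
  by rewrite scale_col_mx scale_scalar_mx mulr1 scalerA divff // scale1r.
rewrite !qformZ !pmulr_rge0 ?exprn_even_gt0 //.
exact: Mz.
Qed.

(** The multiplier enters the matrix only through its lower right block,
    as - l * ball_mx, so taking the Schur complement leaves a pencil in l. *)
Lemma psdmx_lmi_mx {R : realType} {nx na nz : nat}
    (A : 'cV[R]_nx -> 'M[R]_(na, nz)) (a : 'cV[R]_nx -> 'cV[R]_na)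
    (b : 'cV[R]_nx -> 'cV[R]_nz) (c : 'cV[R]_nx -> R) (r : R) (x : 'cV[R]_nx)
    (upsilon k l : R) :
  psdmx (lmi_mx A a b c r x upsilon k l) <->
  forall v, 0 <= qform (gap_mx (A x) (a x) (b x) (c x) upsilon k
                        - l *: ball_mx nz r) v.
Proof.
set h := - (2^-1 *: b x).
pose C := block_mx (- c x + upsilon)%:M h^T h k%:M - l *: ball_mx nz r.
have lmiE : lmi_mx A a b c r x upsilon k l =
    block_mx 1%:M (row_mx (a x) (A x)) (row_mx (a x) (A x))^T C.
  have scalarB m (s t : R) : s%:M - l *: t%:M = (s - l * t)%:M :> 'M_m.
    by rewrite scale_scalar_mx -raddfN -raddfD.
  rewrite /lmi_mx tr_row_mx /C /ball_mx scale_block_mx opp_block_mx add_block_mx.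
  rewrite trmx0 !scaler0 !oppr0 !addr0 !scalarB mulrN1 opprK.
  by rewrite [h^T]linearN /= [(_ *: b x)^T]linearZ.
have CT : C^T = C.
  rewrite /C /ball_mx linearB linearZ /= !tr_block_mx.
  by rewrite !tr_scalar_mx !trmx0 trmxK.
have CE : C - (row_mx (a x) (A x))^T *m row_mx (a x) (A x) =
    gap_mx (A x) (a x) (b x) (c x) upsilon k - l *: ball_mx nz r.
  by rewrite /C addrAC.
rewrite lmiE psdmx_schur CE; split=> [[]|] //.
Qed.

(** * The linear matrix inequality *)

Theorem proposition3 (R : realType) (nx na nz : nat) (X : set 'cV[R]_nx)
    (A : 'cV[R]_nx -> 'M[R]_(na, nz)) (a : 'cV[R]_nx -> 'cV[R]_na)
    (b : 'cV[R]_nx -> 'cV[R]_nz) (c : 'cV[R]_nx -> R)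
    (affA : affine_map A) (affa : affine_map a) (affb : affine_map b)
    (affc : affine_map (V := R^o) c)
    (r : R) (r_gt0 : 0 < r) :
  [/\ majorant_set X A a b c r = lmi_set X A a b c r,
      forall x, X x -> evalg A a b c x 0 = norm2 (a x) ^+ 2 + c x
    & forall x (upsilon : R), X x -> evalg A a b c x 0 < upsilon ->
        exists2 k : R, 0 <= k & majorant_set X A a b c r (x, upsilon, k)].
Proof.
have evalg0 x : evalg A a b c x 0 = norm2 (a x) ^+ 2 + c x.
  by rewrite /evalg !mulmx0 add0r mxE addr0.
split=> // [|x upsilon Xx].
  apply/seteqP; split=> -[[x upsilon] k] [Xx k_ge0].
    move=> major; split=> //.
    have v0_gt0 : 0 < qform (ball_mx nz r) (col_mx 1%:M 0).
      by rewrite qform_ball_mx mulr1 mulmx0 mxE subr0 exprn_gt0.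
    have [z|l l_ge0 psd] := S_lemma (M := gap_mx (A x) (a x) (b x) (c x) upsilon k)
        v0_gt0 (qform_ge0_homogenize _ _).
      by rewrite qform_gap_mx subr_ge0 => /l2ball_qform - /(_ r_gt0) /major.
    by exists l => //; apply/psdmx_lmi_mx.
  move=> [l l_ge0 /psdmx_lmi_mx psd]; split=> // z /l2ball_qform - /(_ r_gt0) z_in.
  have := psd (col_mx 1%:M z); rewrite qformB qform_gap_mx subr_ge0.
  by move=> /(le_trans (mulr_ge0 l_ge0 z_in)); rewrite subr_ge0.
rewrite evalg0 => lt_ups.
pose d := upsilon - (norm2 (a x) ^+ 2 + c x).
have d_gt0 : 0 < d by rewrite subr_gt0.
(* |A z + a|^2 splits into |A z|^2, the linear term 2 (A^T a)^T z, and |a|^2,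
   which [d] accounts for. *)
have [k k_ge0 le_k] := qform_affine_le ((A x)^T *m A x)
  (2 *: ((A x)^T *m a x) + b x) d_gt0.
exists k => //; split=> // z _.
have := le_k z; rewrite qform_mulmx /evalg norm2_sqr dotD /d norm2_sqr.
rewrite [(_ + b x)^T]linearD /= [(2 *: _)^T]linearZ /= mulmxDl -scalemxAl.
rewrite [(_^T *m a x)^T]trmx_mul trmxK -mulmxA.
rewrite [X in _ + X <= _]mxE [X in _ + (X + _) <= _]mxE.
by lra.
Qed.
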